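(* There exists a binary linear $[303,282,3]_2 3,2$ code (length $303$, codimension $21$, minimum distance $3$, covering radius $3$) with a parity-check matrix admitting a $(3,2)$-partition and also a $(3,1)$-partition into at most $35$ subsets. In particular $\ell_2(21,3)\le 303$.
   Context: For an $r\times n$ binary parity-check matrix $H$ and $0\le\ell\le R$, an $(R,\ell)$-partition is a partition of the columns of $H$ into nonempty subsets such that every vector of $\mathbb{F}_2^r$ (including zero) is the sum of at least $\ell$ and at most $R$ columns of $H$ lying in pairwise distinct subsets (zero counts as the empty sum when $\ell=0$). An $[n,n-r,d]_2R,\ell$ code is a binary linear code of length $n$, codimension $r$, minimum distance $d$, covering radius $R$ (smallest $R$ such that every vector of $\mathbb{F}_2^r$ is a sum of at most $R$ columns of a parity-check matrix), some parity-check matrix of which admits an $(R,\ell)$-partition. $\ell_2(r,R)$ is the smallest length of a binary linear code with codimension $r$ and covering radius $R$. *)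

(* Defs.v *)
From HB Require Import structures.
From mathcomp Require Import all_boot all_order all_algebra.
Set Implicit Arguments. Unset Strict Implicit. Unset Printing Implicit Defensive.
Import GRing.Theory.
Local Open Scope ring_scope.

Definition wt (n : nat) (x : 'cV['F_2]_n) : nat := #|[set j : 'I_n | x j 0 != 0]|.

Definition codeword (r n : nat) (H : 'M['F_2]_(r, n)) (x : 'cV['F_2]_n) : Prop :=
  H *m x = 0.

Definition has_codim (r n : nat) (H : 'M['F_2]_(r, n)) : Prop := \rank H = r.

Definition min_dist (r n : nat) (H : 'M['F_2]_(r, n)) (d : nat) : Prop :=
  (forall x, codeword H x -> x != 0 -> (d <= wt x)%N) /\
  (exists x, [/\ codeword H x, x != 0 & wt x = d]).

Definition col_sum (r n : nat) (H : 'M['F_2]_(r, n)) (S : {set 'I_n}) : 'cV['F_2]_r :=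
  \sum_(j in S) col j H.

Definition covers (r n : nat) (H : 'M['F_2]_(r, n)) (R : nat) : Prop :=
  forall s : 'cV['F_2]_r, exists S : {set 'I_n}, (#|S| <= R)%N /\ col_sum H S = s.

Definition cov_radius (r n : nat) (H : 'M['F_2]_(r, n)) (R : nat) : Prop :=
  covers H R /\ forall R', (R' < R)%N -> ~ covers H R'.

(* A partition of the columns into k nonempty subsets, encoded by a surjective
   block-assignment p : 'I_n -> 'I_k.  It is an (R,l)-partition if every vector
   of F_2^r is the sum of at least l and at most R columns lying in pairwise
   distinct subsets. *)
Definition Rl_partition (r n : nat) (H : 'M['F_2]_(r, n)) (R l k : nat)
    (p : 'I_n -> 'I_k) : Prop :=
  (forall b : 'I_k, exists j : 'I_n, p j = b) /\
  forall s : 'cV['F_2]_r, exists S : {set 'I_n},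
    [/\ (l <= #|S|)%N, (#|S| <= R)%N, {in S &, injective p} & col_sum H S = s].

(* ell_2(r,R) <= m: there is a binary linear code of length n <= m, codimension r
   and covering radius R (i.e. the smallest such length is at most m). *)
Definition ell2_le (r R m : nat) : Prop :=
  exists n : nat, (n <= m)%N /\
    exists H : 'M['F_2]_(r, n), has_codim H /\ cov_radius H R.

(* Main.v *)
Require Import Defs.
From HB Require Import structures.
From mathcomp Require Import all_boot all_order all_algebra all_field.
From mathcomp Require Import ring.
Set Implicit Arguments.
Unset Strict Implicit.
Unset Printing Implicit Defensive.
Import GRing.Theory.
Local Open Scope ring_scope.

(** Take a code of length 18 and codimension 9 whose columns [h_i] lie in 17
    blocks, two in the first block and one in every other, such that every vector
    is a sum of one, two or three columns from distinct blocks.  Label the blocks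
    by the 17 points of a conic in the plane over the field with 16 elements, and
    replace [h_i] by the 16 columns [(h_i, x (1, t, t^2))], with [(0, 0, x)] at the
    point at infinity; add the 15 columns [(0, 0, z, 0)], [z] nonzero, coming from
    the nucleus of the conic.  This gives 18 * 16 + 15 = 303 columns in dimension
    9 + 3 * 4 = 21.  Three points of the conic are independent, as are two points
    and the nucleus, which settles a first component that is a sum of three or two
    columns.  If it is a single [h_i], the remaining component lies either on the
    tangent at the point of [h_i], which passes through the nucleus, or on a secant
    through that point and another point; in the second case two columns over the
    same [h_j] are used, so that [h_j] cancels.  Splitting each of the 17 blocks
    into two halves that allow the last step, and keeping the nucleus as one more
    block, gives 35 subsets. *)

(** * Points of a conic and its nucleus in characteristic two *)

Section Conic.
Variable F : fieldType.

Definition conic (P : option F) (x : F) : F * F * F :=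
  if P is Some t then (x, t * x, t ^+ 2 * x) else (0, 0, x).

Definition nucleus (x : F) : F * F * F := (0, x, 0).

Lemma conic_inj P : injective (conic P).
Proof. by case: P => [t|] x y []. Qed.

Lemma conicD P x y : conic P (x + y) = conic P x + conic P y.
Proof. by case: P => [t|] /=; congr (_, _, _); rewrite ?addr0 ?mulrDr. Qed.

Lemma nucleusD x y : nucleus (x + y) = nucleus x + nucleus y.
Proof. by rewrite /nucleus; congr (_, _, _); rewrite addr0. Qed.

(** Homogeneous coordinates [(s, t)] on the projective line; the conic is its image under
    [(s^2, s t, t^2)], which treats the point at infinity like the others. *)
Let hc (P : option F) : F * F := if P is Some t then (1, t) else (0, 1).
Let det P Q := (hc P).1 * (hc Q).2 - (hc P).2 * (hc Q).1.

Let conicE P x : conic P x =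
  ((hc P).1 ^+ 2 * x, (hc P).1 * (hc P).2 * x, (hc P).2 ^+ 2 * x).
Proof. by case: P => [t|] /=; congr (_, _, _); ring. Qed.

Let det_neq0 P Q : P != Q -> det P Q != 0.
Proof.
case: P Q => [t|] [u|] //=; rewrite /det /= ?mul0r ?mulr0 ?mul1r ?mulr1 ?subr0 ?sub0r;
  rewrite ?oppr_eq0 ?oner_eq0 // subr_eq0 => ne.
by apply: contraNneq ne => ->.
Qed.

Lemma conic_span3 P Q R v : P != Q -> P != R -> Q != R ->
  exists x y z, conic P x + conic Q y + conic R z = v.
Proof.
move=> /det_neq0 + /det_neq0 + /det_neq0; rewrite /det.
case: v => [[a b] c].
suff: let: (s1, t1, (s2, t2), (s3, t3)) := (hc P, hc Q, hc R) in
  s1 * t2 - t1 * s2 != 0 -> s1 * t3 - t1 * s3 != 0 ->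
  s2 * t3 - t2 * s3 != 0 -> exists x y z : F,
  [/\ s1 ^+ 2 * x + s2 ^+ 2 * y + s3 ^+ 2 * z = a,
   s1 * t1 * x + s2 * t2 * y + s3 * t3 * z = b &
   t1 ^+ 2 * x + t2 ^+ 2 * y + t3 ^+ 2 * z = c].
  case: (hc P) (conicE P) (hc Q) (conicE Q) (hc R) (conicE R)
    => [s1 t1] EP [s2 t2] EQ [s3 t3] ER /= sol d1 d2 d3.
  have [x [y [z [<- <- <-]]]] := sol d1 d2 d3.
  by exists x, y, z; rewrite EP EQ ER.
case: (hc P) (hc Q) (hc R) => [s1 t1] [s2 t2] [s3 t3] d12 d13 d23.
(* Lagrange interpolation: [L] is the linear form of the line through two points of the conic; at
   the third point it factors, up to sign, into two of the determinants. *)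
pose L s t s' t' := t * t' * a - (s * t' + t * s') * b + s * s' * c.
exists (L s2 t2 s3 t3 / ((s1 * t2 - t1 * s2) * (s1 * t3 - t1 * s3))).
exists (- L s1 t1 s3 t3 / ((s1 * t2 - t1 * s2) * (s2 * t3 - t2 * s3))).
exists (L s1 t1 s2 t2 / ((s1 * t3 - t1 * s3) * (s2 * t3 - t2 * s3))).
by split; rewrite /L; field; rewrite d12 d13 d23.
Qed.

Hypothesis char2 : 2 \in [pchar F].

(** The nucleus absorbs the middle coordinate, so only the outer two must be matched. For two affine
    points that system has determinant [t ^+ 2 - u ^+ 2] up to sign, which in characteristic two is
    the nonzero square [(t - u) ^+ 2]. *)
Lemma conic_span2 P Q v : P != Q ->
  exists x y z, conic P x + conic Q y + nucleus z = v.
Proof.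
case: v => [[a b] c].
case: P Q => [t|] [u|] // ne.
- have d : t - u != 0 by rewrite subr_eq0; apply: contraNneq ne => ->.
  have d2 : (t - u) ^+ 2 = t ^+ 2 - u ^+ 2.
    by rewrite -!(pFrobenius_autE char2) rmorphB.
  pose x := (c - u ^+ 2 * a) / (t - u) ^+ 2.
  have x_d2 : x * (t ^+ 2 - u ^+ 2) = c - u ^+ 2 * a.
    by rewrite -d2 divfK ?expf_neq0.
  exists x, (a - x), (b - t * x - u * (a - x)).
  congr (_, _, _); rewrite /=; try ring.
  by rewrite addr0 -[RHS](subrK (u ^+ 2 * a)) -x_d2; ring.
- by exists a, (c - t ^+ 2 * a), (b - t * a); congr (_, _, _); rewrite /=; ring.
- by exists (c - u ^+ 2 * a), a, (b - u * a); congr (_, _, _); rewrite /=; ring.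
Qed.

(* The tangent lines pass through the nucleus, and the remaining lines through
   a point of the conic are secants. *)
Lemma conic_span1 P v :
  (exists x z, conic P x + nucleus z = v) \/
  (exists Q x y, [/\ Q != P, y != 0 & conic P x + conic Q y = v]).
Proof.
case: v => [[a b] c].
case: P => [t|]; last first.
  have [->|a0] := eqVneq a 0.
    by left; exists c, b; congr (_, _, _); rewrite /=; ring.
  right; exists (Some (b / a)), (c - (b / a) ^+ 2 * a), a; split=> //.
  by congr (_, _, _); rewrite /=; field.
(* [(0, b', c')] is what remains of [v] after subtracting [conic (Some t) a]; the tangent is
   [c' = 0]. *)
pose b' := b - t * a; pose c' := c - t ^+ 2 * a.
have [c0|c0] := eqVneq c' 0.
  left; exists a, b'; congr (_, _, _); rewrite /= /b'; try ring.
  by rewrite addr0; apply/esym/eqP; rewrite -subr_eq0 -/c' c0.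
right; have [b0|b0] := eqVneq b' 0.
  exists None, a, c'; split=> //; congr (_, _, _); rewrite /= /c'; try ring.
  by rewrite addr0; apply/esym/eqP; rewrite -subr_eq0 -/b' b0.
have y0 : b' ^+ 2 / c' != 0 by rewrite mulf_neq0 ?expf_neq0 ?invr_eq0.
(* For the second point [t + d], the equations [y d = b'] and [y d^2 = c'] force [d = c' / b'] and
   [y = b'^2 / c']. *)
exists (Some (t + c' / b')), (a - b' ^+ 2 / c'), (b' ^+ 2 / c'); split=> //.
  apply: contraNneq c0 => -[] /eqP.
  by rewrite -subr_eq0 addrAC subrr add0r mulf_eq0 invr_eq0 (negPf b0) orbF => ->.
have d2 : (t + c' / b') ^+ 2 = t ^+ 2 + (c' / b') ^+ 2.
  by rewrite -!(pFrobenius_autE char2) rmorphD.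
congr (_, _, _); rewrite /= ?d2.
- ring.
- have -> : b = b' + t * a by rewrite /b' addrNK.
  by field; rewrite b0 c0.
have -> : c = c' + t ^+ 2 * a by rewrite /c' addrNK.
by field; rewrite b0 c0.
Qed.
End Conic.

(** * Replacing the columns of a code by points of the conic *)

Section Concatenation.
Variables (F : finFieldType) (I : finType) (m r : nat).
Variables (rho : {additive F -> 'cV['F_2]_m}) (h : I -> 'cV['F_2]_r).
Variables (blk : I -> option F) (rep : option F -> I).
Hypotheses (rho_inj : injective rho) (rho_surj : forall u, exists x, rho x = u).
Hypotheses (h_inj : injective h) (h_neq0 : forall i, h i != 0).
Hypotheses (repK : cancel rep blk).
Hypothesis h_cover : forall s, exists L : seq I,
  [/\ (0 < size L <= 3)%N, uniq (map blk L) & \sum_(i <- L) h i = s].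
Hypotheses (char2 : 2 \in [pchar F]) (card_gt2 : (2 < #|F|)%N).

Local Notation label := (I * F + {x : F | x != 0})%type.

Definition word (u : 'cV['F_2]_r) (v : F * F * F) : 'cV['F_2]_(r + (m + (m + m))) :=
  col_mx u (col_mx (rho v.1.1) (col_mx (rho v.1.2) (rho v.2))).

Lemma word_inj u v u' v' : word u v = word u' v' -> u = u' /\ v = v'.
Proof.
case: v v' => [[a b] c] [[a' b'] c'] /=.
by case/eq_col_mx=> -> /eq_col_mx [/rho_inj /= -> /eq_col_mx [/rho_inj /= -> /rho_inj /= ->]].
Qed.

Lemma wordD u v u' v' : word u v + word u' v' = word (u + u') (v + v').
Proof. by rewrite /word !add_col_mx !raddfD. Qed.

Lemma word_surj s : exists u v, word u v = s.
Proof.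
rewrite -[s]vsubmxK -[dsubmx s]vsubmxK -[dsubmx (dsubmx s)]vsubmxK.
have [a Ea] := rho_surj (usubmx (dsubmx s)).
have [b Eb] := rho_surj (usubmx (dsubmx (dsubmx s))).
have [c Ec] := rho_surj (dsubmx (dsubmx (dsubmx s))).
by exists (usubmx s), (a, b, c); rewrite /word Ea Eb Ec.
Qed.

Definition column (t : label) : 'cV['F_2]_(r + (m + (m + m))) :=
  match t with
  | inl (i, x) => word (h i) (conic (blk i) x)
  | inr z => word 0 (nucleus (val z))
  end.

Lemma column_inj : injective column.
Proof.
move=> [[i x]|z] [[j y]|w] /word_inj [].
- by move=> /h_inj <- /conic_inj <-.
- by move=> h0; have := h_neq0 i; rewrite h0 eqxx.
- by move=> h0; have := h_neq0 j; rewrite -h0 eqxx.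
- by move=> _ [] /val_inj <-.
Qed.

Lemma column_neq0 t : column t != 0.
Proof.
apply/eqP; have <- : word 0 0 = 0 by rewrite /word /= !raddf0 !col_mx0.
case: t => [[i x]|z] /word_inj [].
  by move=> h0; have := h_neq0 i; rewrite h0 eqxx.
by move=> _ [] z0; have /eqP := valP z.
Qed.

(* In every block of [blk] one column is set apart, so that each nonzero field
   element is a difference across the two halves of the block. *)
Definition half_block (t : label) : option (option F * bool) :=
  match t with
  | inl (i, x) => Some (blk i, (x == 0) && (i == rep (blk i)))
  | inr _ => None
  end.

Lemma half_block_surj b : exists t, half_block t = b.
Proof.
case: b => [[P []]|].
- by exists (inl (rep P, 0)); rewrite /= repK !eqxx.
- by exists (inl (rep P, 1)); rewrite /= repK oner_eq0.
- by exists (inr (Sub 1 (oner_neq0 F))).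
Qed.

Let addvv (k : nat) (u : 'cV['F_2]_k) : u + u = 0.
Proof. by rewrite -mulr2n -scaler_nat pchar_Zp // scale0r. Qed.

(** There is no column for [z = 0], so the nucleus term is a list of at most one column. *)
Lemma column_nucleus z : exists L : seq label,
  [/\ (size L <= 1)%N, map half_block L = nseq (size L) None &
   \sum_(t <- L) column t = word 0 (nucleus z)].
Proof.
have [->|z0] := eqVneq z 0.
  by exists [::]; rewrite big_nil /word /= !raddf0 !col_mx0.
by exists [:: inr (Sub z z0)]; rewrite big_seq1.
Qed.

Lemma half_block_cover s : exists L : seq label,
  [/\ (0 < size L <= 3)%N, uniq (map half_block L) & \sum_(t <- L) column t = s].
Proof.
have someE (P Q : option F) (b c : bool) :
  (Some (P, b) == Some (Q, c)) = (P == Q) && (b == c) by [].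
have [u [v <-]] := word_surj s.
have [L [szL]] := h_cover u.
case: L szL => [|i [|j [|k []]]] //= _.
- rewrite big_seq1 => _ <-; have [[x [z <-]]|] := conic_span1 char2 (blk i) v.
    have [Z [szZ EZ sumZ]] := column_nucleus z.
    exists (inl (i, x) :: Z); split.
    - by case: (Z) szZ => [|? []].
    - by rewrite map_cons EZ; case: (Z) szZ => [|? []].
    by rewrite big_cons sumZ wordD addr0.
  move=> [Q [x [y [neQ y0 <-]]]].
  (* The columns over [rep Q] lie in opposite halves of block [Q] because [y] is nonzero, and their
     first components cancel. *)
  exists [:: inl (i, x); inl (rep Q, 0); inl (rep Q, y)]; split=> //=.
    by rewrite !inE !someE repK !eqxx (negPf y0) [blk i == Q]eq_sym (negPf neQ).
  rewrite !big_cons big_nil addr0 /= repK !wordD addvv addr0.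
  by rewrite -conicD add0r.
- rewrite inE andbT => neij; rewrite !big_cons big_nil addr0 => <-.
  have [x [y [z <-]]] := conic_span2 char2 v neij.
  have [Z [szZ EZ sumZ]] := column_nucleus z.
  exists (inl (i, x) :: inl (j, y) :: Z); split.
  - by case: (Z) szZ => [|? []].
  - rewrite !map_cons EZ; case: (Z) szZ => [|? []] //= _;
    by rewrite !inE ?orbF ?andbT someE (negPf neij).
  by rewrite !big_cons sumZ !wordD addr0 addrA.
rewrite !inE andbT negb_or -andbA => /and3P [neij neik nejk].
rewrite !big_cons big_nil addr0 => <-.
have [x [y [z <-]]] := conic_span3 v neij neik nejk.
exists [:: inl (i, x); inl (j, y); inl (k, z)]; split=> //=.
  by rewrite !inE !someE (negPf neij) (negPf neik) (negPf nejk).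
by rewrite !big_cons big_nil addr0 !wordD -!addrA.
Qed.

(* A sum with a single term is broken up: [x = (x+1) + (x+w) + (x+1+w)] over the
   same [h_i], and [z = w + (z+w)] over the nucleus. *)
Lemma column_cover s : exists L : seq label,
  [/\ (1 < size L <= 3)%N, uniq L & \sum_(t <- L) column t = s].
Proof.
have [L [szL /map_uniq uL <-]] := half_block_cover s.
case: L szL uL => [|t [|t' L]] // szL uL; last by exists (t :: t' :: L).
have other (x : F) : exists y, y \notin [:: 0; x].
  apply/existsP; rewrite -negb_forall; apply: contraL card_gt2 => /forallP all_in.
  rewrite -leqNgt; apply: leq_trans (card_size [:: 0; x]).
  by apply/subset_leq_card/subsetP=> y _; apply: all_in.
have addxx (x : F) : x + x = 0 by rewrite -mulr2n mulrn_pchar.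
have oppx (x : F) : - x = x by apply/eqP; rewrite eq_sym -addr_eq0 addxx.
rewrite big_seq1; case: t {szL uL} => [[i x]|z].
  (* With [w] outside {0, 1}, the offsets [1], [w], [1 + w] are pairwise distinct and sum to
     zero. *)
  have [w] := other 1; rewrite !inE negb_or => /andP [w0 w1].
  exists [:: inl (i, x + 1); inl (i, x + w); inl (i, x + (1 + w))]; split=> //.
    have inE1 a b : (inl (i, x + a) == inl (i, x + b) :> label) = (a == b).
      by rewrite -[LHS]/((i, x + a) == (i, x + b)) xpair_eqE eqxx (inj_eq (addrI x)).
    rewrite /= !inE !inE1 negb_or andbT eq_sym w1 -{1}[1]addr0 (inj_eq (addrI 1)).
    by rewrite eq_sym w0 -{1}[w]add0r (inj_eq (addIr w)) eq_sym oner_neq0.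
  rewrite !big_cons big_nil addr0 /= !wordD addvv addr0 -!conicD.
  congr (word _ (conic _ _)).
  have -> : x + 1 + (x + w + (x + (1 + w))) = x + (x + x + (1 + 1) + (w + w)) by ring.
  by rewrite !addxx !addr0.
have [w] := other (val z); rewrite !inE negb_or => /andP [w0 wz].
have zw0 : val z + w != 0 by rewrite addr_eq0 oppx eq_sym.
exists [:: inr (Sub w w0); inr (Sub (val z + w) zw0)]; split=> //=.
  rewrite inE andbT -[_ == _]/(w == val z + w) -{1}[w]add0r (inj_eq (addIr w)).
  by rewrite eq_sym (valP z).
rewrite !big_cons big_nil addr0 wordD addr0 -nucleusD.
by rewrite addrCA addxx addr0.
Qed.

End Concatenation.

(** * The base code of length 18 and codimension 9 *)

(** Boolean lists mirror the vectors over ['F_2], so that the covering property can be decided by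
    evaluation. *)
Fixpoint bits (k n : nat) : bitseq :=
  if k is k'.+1 then odd n :: bits k' n./2 else [::].

Fixpoint all_bits (k : nat) : seq bitseq :=
  if k is k'.+1 then map (cons false) (all_bits k') ++ map (cons true) (all_bits k')
  else [:: [::]].

Lemma mem_all_bits w : w \in all_bits (size w).
Proof.
elim: w => [|[] w IH] //=; rewrite mem_cat; apply/orP; [right|left];
  by apply/mapP; exists w.
Qed.

Definition bitxor (u v : bitseq) : bitseq := [seq p.1 (+) p.2 | p <- zip u v].

Definition bitvec (k : nat) (w : bitseq) : 'cV['F_2]_k :=
  \col_i (nth false w i : nat)%:R.

Lemma bitvec_xor k u v : size u = k -> size v = k ->
  bitvec k (bitxor u v) = bitvec k u + bitvec k v.
Proof.
move=> szu szv; apply/colP=> i; rewrite !mxE.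
have ltiz : (i < size (zip u v))%N by rewrite size_zip szu szv minnn.
rewrite (nth_map (false, false)) // nth_zip ?szu ?szv //=.
by case: (nth _ u i) (nth _ v i) => [] []; apply/val_inj.
Qed.

Lemma bitvec_inj k u v : size u = k -> size v = k -> bitvec k u = bitvec k v -> u = v.
Proof.
move=> szu szv /colP euv; apply: (@eq_from_nth _ false); first by rewrite szu.
move=> i; rewrite szu => lti; have := euv (Ordinal lti); rewrite !mxE /=.
by case: (nth _ u i) (nth _ v i) => [] [] // /(congr1 val).
Qed.

Lemma bitvec_surj k (s : 'cV['F_2]_k) : exists2 w, size w = k & bitvec k w = s.
Proof.
exists (mkseq (fun i => if insub i is Some j then s j 0 != 0 else false) k).
  by rewrite size_mkseq.
apply/colP=> i; rewrite !mxE nth_mkseq // valK.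
by case: (s i 0) => [[|[|]]] // lt; apply/val_inj.
Qed.

(* Found by computer search, then brought to systematic form; the binary digits
   of each number, lowest first, are the entries of a column. *)
Definition base_words : seq bitseq := map (bits 9)
  [:: 1; 2; 4; 8; 16; 32; 64; 128; 256; 18; 139; 151; 153; 236; 301; 460; 499; 446]%N.

Definition base_word (i : nat) : bitseq := nth [::] base_words i.

(* Columns [0] and [17] share a block. *)
Definition base_block (i : nat) : nat := (i %% 17)%N.

(** Index lists are generated in nondecreasing order; the filter drops repeated indices, since these
    share a block. *)
Definition block_transversals : seq (seq nat) :=
  [seq L <- [seq [:: i] | i <- iota 0 18]
         ++ [seq [:: i; j] | i <- iota 0 18, j <- iota i (18 - i)]
         ++ [seq i :: L | i <- iota 0 18,
               L <- [seq [:: j; k] | j <- iota i (18 - i), k <- iota j (18 - j)]]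
   | [&& (0 < size L <= 3)%N, all (fun i => i < 18)%N L & uniq (map base_block L)]].

Definition sum_words (L : seq nat) : bitseq :=
  foldr bitxor (nseq 9 false) (map base_word L).

Lemma base_words_cover : {subset all_bits 9 <= map sum_words block_transversals}.
Proof. by apply/allP; vm_compute. Qed.

Lemma size_bits k n : size (bits k n) = k.
Proof. by elim: k n => //= k IH n; rewrite IH. Qed.

Lemma size_base_word i : (i < 18)%N -> size (base_word i) = 9%N.
Proof. by move=> lti; rewrite /base_word (nth_map 0%N) // size_bits. Qed.

Definition base_col (i : 'I_18) : 'cV['F_2]_9 := bitvec 9 (base_word i).

Lemma base_col_inj : injective base_col.
Proof.
move=> i j eij; apply/val_inj/eqP.
rewrite -(@nth_uniq _ [::] base_words) ?size_map ?ltn_ord //.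
by apply/eqP/(bitvec_inj _ _ eij); apply: size_base_word.
Qed.

Lemma base_col_neq0 i : base_col i != 0.
Proof.
have -> : 0 = bitvec 9 (nseq 9 false) by apply/colP=> j; rewrite !mxE nth_nseq if_same.
apply/eqP=> e0; have {}e0 := bitvec_inj (size_base_word (ltn_ord i)) (size_nseq 9 false) e0.
have : base_word i \in base_words by apply: mem_nth.
by rewrite e0.
Qed.

Lemma sum_wordsP (L : seq 'I_18) :
  size (sum_words (map val L)) = 9%N /\
  bitvec 9 (sum_words (map val L)) = \sum_(i <- L) base_col i.
Proof.
elim: L => [|i L [szL IH]].
  by rewrite big_nil; split=> //; apply/colP=> j; rewrite !mxE nth_nseq if_same.
have szi := size_base_word (ltn_ord i).
rewrite big_cons -IH /= bitvec_xor // /bitxor size_map size_zip.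
by rewrite szi szL.
Qed.

Lemma base_cover (s : 'cV['F_2]_9) : exists L : seq 'I_18,
  [/\ (0 < size L <= 3)%N, uniq (map (fun i => base_block (val i)) L) &
      \sum_(i <- L) base_col i = s].
Proof.
have [w szw <-] := bitvec_surj s.
have w_in : w \in all_bits 9 by rewrite -szw mem_all_bits.
have /mapP [L + ->] := base_words_cover w_in.
rewrite mem_filter => /andP [/and3P [szL /allP ltL uL] _].
exists (map inord L); have valL : map val (map (@inord 17) L) = L.
  by rewrite -map_comp map_id_in // => i /ltL lti /=; rewrite inordK.
by rewrite size_map (map_comp base_block) valL -(sum_wordsP _).2 valL.
Qed.

(** * Parity-check matrices *)

Section ParityCheck.
Variables (r n : nat) (H : 'M['F_2]_(r, n)).
Implicit Types (x : 'cV['F_2]_n) (S : {set 'I_n}).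

Lemma F2_eq1 (a : 'F_2) : a != 0 -> a = 1.
Proof. by case: a => [[|[|]]] // lt _; apply/val_inj. Qed.

Lemma mulmx_col_sum x : H *m x = col_sum H [set j | x j 0 != 0].
Proof.
apply/colP=> i; rewrite !mxE summxE [RHS]big_mkcond /=.
apply: eq_bigr => j _; rewrite inE mxE.
by have [->|/F2_eq1->] := eqVneq (x j 0) 0; rewrite ?mulr0 ?mulr1.
Qed.

Lemma mulmx_indicator S : H *m (\col_j (j \in S)%:R) = col_sum H S.
Proof.
rewrite mulmx_col_sum; congr col_sum; apply/setP=> j; rewrite inE mxE.
by case: (j \in S).
Qed.

(** Over ['F_2], codewords are sets of columns with sum zero. One column of sum zero would be zero,
    and two would be equal. *)
Lemma min_dist3 : injective (fun j => col j H) -> (forall j, col j H != 0) ->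
  (exists S, [/\ S != set0, (#|S| <= 3)%N & col_sum H S = 0]) -> min_dist H 3.
Proof.
move=> col_inj col_neq0 [S [S0 leS3 sumS]].
have card_dep A : A != set0 -> col_sum H A = 0 -> (2 < #|A|)%N.
  rewrite -card_gt0 => gt0 sumA; rewrite ltnNge leq_eqVlt ltnS; apply/negP.
  case/orP=> [/cards2P [i [j [neij Aij]]]|le1]; last first.
    have /cards1P [j Aj] : #|A| == 1%N by rewrite eqn_leq gt0 andbT.
    by have := col_neq0 j; rewrite -sumA /col_sum Aj big_set1 eqxx.
  case/negP: (neij); apply/eqP/col_inj.
  apply/eqP; rewrite -subr_eq0 -[X in _ - X]opprK; apply/eqP.
  rewrite -sumA /col_sum Aij big_setU1 ?in_set1 //= big_set1; congr (_ + _).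
  by apply/colP=> k; rewrite !mxE; case: (H k j) => [[|[|]]] // lt; apply/val_inj.
split=> [x Hx x0|].
  rewrite /wt; apply: card_dep; last by rewrite -mulmx_col_sum.
  apply: contraNneq x0 => S0x; apply/eqP/colP=> j; rewrite mxE; apply/eqP.
  by have := in_set0 j; rewrite -S0x inE => /negbFE.
have suppS : [set j | (\col_j (j \in S)%:R : 'cV['F_2]_n) j 0 != 0] = S.
  by apply/setP=> j; rewrite inE mxE; case: (j \in S).
exists (\col_j (j \in S)%:R); split.
- by rewrite /codeword mulmx_indicator.
- by apply: contraNneq S0 => x0; rewrite -suppS x0; apply/eqP/setP=> j; rewrite !inE mxE eqxx.
- by rewrite /wt suppS; apply/eqP; rewrite eqn_leq leS3 card_dep.
Qed.

(** Every unit vector is a sum of columns, which yields a right inverse of [H]. *)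
Lemma covers_rank R : covers H R -> \rank H = r.
Proof.
move=> covH; apply/eqP; rewrite -/(row_free H); apply/row_freeP.
have inv j : exists x, H *m x = col j 1%:M.
  by have [S [_ <-]] := covH (col j 1%:M); exists (\col_j (j \in S)%:R); rewrite mulmx_indicator.
have [X HX] := fin_all_exists inv.
exists (\matrix_(i, j) X j i 0); apply/matrixP=> i j.
have := congr1 (fun v : 'cV_r => v i 0) (HX j); rewrite !mxE => <-.
by apply: eq_bigr => k _; rewrite !mxE.
Qed.

(** Counting bound: a sum of at most two columns is the value of [f] at a pair of optional
    columns. *)
Lemma covers_card2 : covers H 2 -> (2 ^ r <= n.+1 ^ 2)%N.
Proof.
move=> covH; have <- : #|{: 'cV['F_2]_r}| = (2 ^ r)%N by rewrite card_mx card_Fp // muln1.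
have <- : #|{: option 'I_n * option 'I_n}| = (n.+1 ^ 2)%N.
  by rewrite card_prod card_option card_ord.
pose f (q : option 'I_n * option 'I_n) :=
  oapp (fun j => col j H) 0 q.1 + oapp (fun j => col j H) 0 q.2.
suff f_surj s : exists q, f q = s.
  have [g gK] := fin_all_exists f_surj.
  by apply: (@leq_card _ _ g); apply: can_inj gK.
have [S [leS2 <-]] := covH s; rewrite /f /col_sum.
case: (ltngtP #|S| 1%N) => [||/eqP/cards1P [j ->]].
- rewrite ltnS leqn0 cards_eq0 => /eqP ->.
  by exists (None, None); rewrite big_set0 addr0.
- move=> gt1; have /cards2P [i [j [neij ->]]] : #|S| == 2 by rewrite eqn_leq leS2.
  by exists (Some i, Some j); rewrite big_setU1 ?in_set1 //= big_set1.
- by exists (Some j, None); rewrite big_set1 addr0.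
Qed.

Lemma Rl_partition_covers R l k (p : 'I_n -> 'I_k) : Rl_partition H R l p -> covers H R.
Proof. by case=> _ cov s; have [S [_ leSR _ sumS]] := cov s; exists S. Qed.
End ParityCheck.

(** * Matrices whose columns are indexed by a finite type *)

Section ColumnFamily.
Variables (T : finType) (r n : nat) (g : T -> 'cV['F_2]_r).
Hypothesis cardT : #|T| = n.

Definition ord_label (j : 'I_n) : T := enum_val (cast_ord (esym cardT) j).
Definition family_mx : 'M['F_2]_(r, n) := \matrix_(i, j) g (ord_label j) i 0.

Lemma ord_label_bij : bijective ord_label.
Proof.
exists (fun t => cast_ord cardT (enum_rank t)) => [j|t]; rewrite /ord_label.
  by rewrite enum_valK cast_ordKV.
by rewrite cast_ordK enum_rankK.
Qed.

Lemma col_family_mx j : col j family_mx = g (ord_label j).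
Proof. by apply/colP=> i; rewrite !mxE. Qed.

Lemma family_mx_partition R l (B : finType) (p : T -> B) :
  (forall b, exists t, p t = b) ->
  (forall s, exists L : seq T,
    [/\ (l <= size L <= R)%N, uniq (map p L) & \sum_(t <- L) g t = s]) ->
  Rl_partition family_mx R l (fun j => enum_rank (p (ord_label j))).
Proof.
have [lab labK ordK] := ord_label_bij.
move=> p_surj covg; split=> [b|s].
  have [t pt] := p_surj (enum_val b).
  by exists (lab t); rewrite ordK pt enum_valK.
have [L [/andP [leL leR] uL sumL]] := covg s.
have uL' : uniq (map lab L).
  by rewrite map_inj_uniq ?(map_uniq uL) //; apply: can_inj ordK.
have cardS : #|[set j in map lab L]| = size L.
  by rewrite cardsE (card_uniqP uL') size_map.
exists [set j in map lab L]; rewrite cardS; split=> //.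
  (* Injectivity on the chosen columns is shown by counting: their blocks are as many as the entries
     of [L]. *)
  apply/imset_injP; rewrite cardS.
  have -> : [set enum_rank (p (ord_label j)) | j in [set j in map lab L]] =
    [set b in map enum_rank (map p L)].
    apply/setP=> b; rewrite inE -map_comp; apply/imsetP/mapP.
      by case=> j; rewrite inE => /mapP [t tL ->] ->; exists t => //; rewrite ordK.
    by case=> t tL ->; exists (lab t); rewrite ?ordK // inE map_f.
  rewrite cardsE (card_uniqP _) ?size_map // map_inj_uniq //; exact: enum_rank_inj.
rewrite /col_sum -sumL (eq_bigl (mem (map lab L))) => [|j]; last by rewrite !inE.
rewrite -big_uniq //= big_map; apply: eq_bigr => t _.
by rewrite col_family_mx ordK.
Qed.
End ColumnFamily.

(** * The field with 16 elements as a binary space, and the code of length 303 *)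

Lemma F16_F2_space : exists (F : finFieldType) (rho : {additive F -> 'cV['F_2]_4}),
  [/\ 2 \in [pchar F], #|F| = 16%N, injective rho & forall u, exists x, rho x = u].
Proof.
have [F char2 cardF] := @pPrimePowerField 2 4 isT isT.
have := pprimeChar_vectAxiom char2; rewrite cardF (_ : logn 2 (2 ^ 4) = 4) //.
case=> f lin_f [f' fK f'K].
pose rho (x : F) : 'cV['F_2]_4 := (f x)^T.
have rhoB : {morph rho : x y / x - y}.
  move=> x y; rewrite /rho -linearB; congr (_^T).
  by have := lin_f (-1) y x; rewrite !scaleN1r [x - y]addrC [RHS]addrC.
pose rhoM := GRing.isZmodMorphism.Build F 'cV['F_2]_4 rho rhoB.
pose rhoA : {additive F -> 'cV['F_2]_4} := HB.pack rho rhoM.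
exists F, rhoA; split=> // [x y /trmx_inj /(can_inj fK) //|u].
by exists (f' u^T); rewrite /= /rho f'K trmxK.
Qed.

Theorem theorem7p2 :
  (exists H : 'M['F_2]_(21, 303),
    [/\ has_codim H, min_dist H 3, cov_radius H 3,
        (exists (k : nat) (p : 'I_303 -> 'I_k), Rl_partition H 3 2 p) &
        (exists (k : nat) (p : 'I_303 -> 'I_k), (k <= 35)%N /\ Rl_partition H 3 1 p)])
  /\ ell2_le 21 3 303.
Proof.
suff [H [rkH dH covH p2 p1]] : exists H : 'M['F_2]_(21, 303),
    [/\ has_codim H, min_dist H 3, cov_radius H 3,
        (exists (k : nat) (p : 'I_303 -> 'I_k), Rl_partition H 3 2 p) &
        (exists (k : nat) (p : 'I_303 -> 'I_k), (k <= 35)%N /\ Rl_partition H 3 1 p)].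
  by split; [exists H | exists 303%N; split=> //; exists H].
have [F [rho [char2 cardF rho_inj rho_surj]]] := F16_F2_space.
have cardP : #|{: option F}| = 17%N by rewrite card_option cardF.
have [lab labK ordK] := ord_label_bij cardP.
pose blk (i : 'I_18) : option F := ord_label cardP (inord (base_block i)).
(* The representatives are the base columns 0 to 16, one in each block. *)
pose rep (P : option F) : 'I_18 := widen_ord (leqnSn 17) (lab P).
have repK : cancel rep blk.
  move=> P; rewrite /blk /base_block /= modn_small ?ltn_ord // inord_val; exact: ordK.
have h_cover s : exists L : seq 'I_18,
    [/\ (0 < size L <= 3)%N, uniq (map blk L) & \sum_(i <- L) base_col i = s].
  have [L [szL uL sumL]] := base_cover s; exists L; split=> //.
  have -> : map blk L = map (ord_label cardP \o inord) (map (fun i => base_block (val i)) L).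
    by rewrite -map_comp.
  rewrite map_inj_in_uniq // => _ _ /mapP [i _ ->] /mapP [j _ ->] /(can_inj labK).
  by move/(congr1 val); rewrite /= !inordK ?ltn_pmod.
have cardT : #|{: 'I_18 * F + {x : F | x != 0}}| = 303%N.
  by rewrite card_sum card_prod card_ord cardF card_sig (cardC1 (0 : F)) cardF.
have cardB : #|{: option (option F * bool)}| = 35%N.
  by rewrite card_option card_prod cardP card_bool.
pose g : _ -> 'cV['F_2]_21 := column rho base_col blk.
have g_inj : injective g
  by exact: (@column_inj F _ 4 9 rho base_col blk rho_inj base_col_inj base_col_neq0).
have g_neq0 t : g t != 0
  by exact: (@column_neq0 F _ 4 9 rho base_col blk rho_inj base_col_neq0).
have card_gt2 : (2 < #|F|)%N by rewrite cardF.
pose H := family_mx g cardT; exists H.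
(* The partition into singletons, for which distinct columns suffice. *)
have p2 : Rl_partition H 3 2 (fun j => enum_rank (ord_label cardT j)).
  apply: (@family_mx_partition _ _ _ g cardT 3 2 _ id) => [t|s]; first by exists t.
  have [L [szL uL sumL]] :=
    column_cover rho_surj repK h_cover char2 card_gt2 s.
  by exists L; rewrite map_id.
have p1 : Rl_partition H 3 1
    (fun j => enum_rank (half_block blk rep (ord_label cardT j))).
  apply: (@family_mx_partition _ _ _ g cardT 3 1) => [b|s].
    exact: (half_block_surj repK).
  exact: (half_block_cover rho_surj repK h_cover char2 s).
have colE j : col j H = g (ord_label cardT j) := col_family_mx g cardT j.
have covH := Rl_partition_covers p2.
split; last 2 first.
- by eexists; eexists; exact: p2.
- by eexists; eexists; split; last exact: p1; rewrite cardB.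
- exact: covers_rank covH.
- apply: min_dist3 => [i j||].
  + by rewrite !colE => /g_inj /(bij_inj (ord_label_bij cardT)).
  + by move=> j; rewrite colE.
  (* Writing zero as a sum of two or three columns gives the required dependency. *)
  have [S [leS Sle _ sumS]] := p2.2 0.
  by exists S; split; rewrite // -card_gt0 (leq_trans _ leS).
split=> // R' ltR' cov'.
have /covers_card2 : covers H 2.
  by move=> s; have [S [leS sumS]] := cov' s; exists S; rewrite (leq_trans leS).
(* Radius two is excluded because 304 is at most [2 ^ 9], so [304 ^ 2] is at most [2 ^ 18], below
   [2 ^ 21]. *)
apply/negP; rewrite -ltnNge; apply: (@leq_ltn_trans (2 ^ (9 * 2))).
  by rewrite expnM leq_exp2r.
by rewrite ltn_exp2l.
Qed.
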